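(* Let $\kappa$ be a regular uncountable cardinal. Suppose that $\kappa$ is a subtle cardinal and that $\boxtimes^-(\kappa)$ holds. Then there exists a full $\kappa$-Souslin tree.
   Context: Trees. A partially ordered set $\mathbf T=(T,<_T)$ is a $\kappa$-tree iff: (1) for every $x\in T$, the set $x_\downarrow:=\{y\in T\mid y<_T x\}$ is well-ordered by $<_T$; write $\mathrm{ht}(x):=\mathrm{otp}(x_\downarrow,<_T)$; (2) for every $\alpha<\kappa$, the level $T_\alpha:=\{x\in T\mid \mathrm{ht}(x)=\alpha\}$ is nonempty and has size less than $\kappa$, and the level $T_\kappa$ is empty. For an ordinal $\alpha$, a subset $B\subseteq T$ is an $\alpha$-branch iff $B$ is linearly ordered by $<_T$ and $\{\mathrm{ht}(x)\mid x\in B\}=\alpha$. It is vanishing iff there is no $y\in T$ such that $x\le_T y$ for all $x\in B$. A $\kappa$-tree is full iff for every limit ordinal $\alpha<\kappa$ it has at most one vanishing $\alpha$-branch. A $\kappa$-tree is $\kappa$-Souslin iff it has no $\kappa$-branches and no antichains (sets of pairwise incomparable nodes) of size $\kappa$. Subtle cardinals. $\kappa$ is subtle iff for every sequence of sets $\langle A_\beta\mid\beta\in D\rangle$ indexed by a club $D\subseteq\kappa$, there is a pair $\beta<\alpha$ of ordinals in $D$ such that $A_\beta\cap\beta=A_\alpha\cap\beta$. The principle $\boxtimes^-(\kappa)$. For a set of ordinals $C$, let $\mathrm{acc}(C):=\{\alpha\in C\mid \sup(C\cap\alpha)=\alpha>0\}$ and $\mathrm{nacc}(C):=C\setminus\mathrm{acc}(C)$.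 A $C$-sequence over $\kappa$ is a sequence $\langle C_\alpha\mid\alpha<\kappa\rangle$ such that for every $\alpha<\kappa$, $C_\alpha$ is a closed subset of $\alpha$ with $\sup(C_\alpha)=\sup(\alpha)$. Write $D\sqsubseteq C$ iff $D=C\cap\beta$ for some ordinal $\beta$. The $C$-sequence is $\sqsubseteq$-coherent iff $C_\beta\sqsubseteq C_\alpha$ for all $\beta<\alpha<\kappa$ with $\beta\in\mathrm{acc}(C_\alpha)$. $\boxtimes^-(\kappa)$ asserts the existence of a $\sqsubseteq$-coherent $C$-sequence $\langle C_\alpha\mid\alpha<\kappa\rangle$ such that for every cofinal $B\subseteq\kappa$ there are stationarily many $\alpha<\kappa$ with $\sup(\mathrm{nacc}(C_\alpha)\cap B)=\alpha$. *)

(* Defs.v *)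
From mathcomp Require Import all_boot all_order.
From mathcomp Require Import all_classical wochoice.

Set Implicit Arguments.
Unset Strict Implicit.
Unset Printing Implicit Defensive.

Import Order.TTheory.
Local Open Scope classical_set_scope.
Local Open Scope card_scope.
Local Open Scope order_scope.

(* A cardinal kappa is a well-ordered type K none of whose proper initial
   segments has the cardinality of K.  The elements of K are the ordinals below
   kappa.  As for von Neumann ordinals, an ordinal is also a set of ordinals:
   a < kappa is the segment [init a], and kappa itself is [setT : set K]. *)

Definition init d (T : porderType d) (x : T) : set T := [set y | y < x].

Section Ordinals.
Variables (d : Order.disp_t) (K : orderType d).
Implicit Types (a b : K) (A B C D : set K).

Definition cofinal B := forall a, exists2 b, B b & a <= b.

(* Cardinalities are comparable, so this says |X| < kappa. *)
Definition small U (X : set U) : Prop := ~~ ([set: K] #<= X).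

Definition regular_uncountable_cardinal :=
  [/\ well_order (<=%O : rel K),
      forall a, small (init a),
      forall B, cofinal B -> B #= [set: K]
    & ~ countable [set: K]].

(* sup (C `&` a) = a > 0; the least upper bound of the empty set is 0. *)
Definition limit_point C a := init a !=set0 /\ isLub (C `&` init a) a.

Definition limit_ordinal a := limit_point setT a.

Definition acc C : set K := [set a | C a /\ limit_point C a].
Definition nacc C : set K := C `\` acc C.

(* I is init a or setT, according to whether the ambient ordinal is a < kappa
   or kappa. *)
Definition closed_in (I C : set K) :=
  C `<=` I /\ forall a, I a -> limit_point C a -> C a.

Definition club D := closed_in setT D /\ cofinal D.

Definition stationary A := forall D, club D -> A `&` D !=set0.

(* The sets A_b only matter through their intersection with kappa. *)
Definition subtle :=
  forall (D : set K) (A : K -> set K), club D ->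
    exists a b, [/\ D b, D a, b < a & A b `&` init b = A a `&` init b].

Definition C_sequence (C : K -> set K) :=
  forall a, closed_in (init a) (C a) /\ supremums (C a) = supremums (init a).

(* Only used for sets bounded in kappa, so letting b range over ordinals
   >= kappa as well would not change the relation. *)
Definition initial_part D C := exists b, D = C `&` init b.

Definition coherent (C : K -> set K) :=
  forall a b, b < a -> acc (C a) b -> initial_part (C b) (C a).

Definition box_minus :=
  exists C : K -> set K,
    [/\ C_sequence C, coherent C
      & forall B, cofinal B ->
          stationary [set a | isLub (nacc (C a) `&` B) a]].

End Ordinals.

Section Trees.
Variables (d : Order.disp_t) (K : orderType d).
Variables (d' : Order.disp_t) (T : porderType d').
Implicit Types (x y : T) (B X : set T) (I : set K).

(* I, an initial segment of K, is the order type of the predecessors of x. *)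
Definition has_height x I :=
  exists2 f : T -> K, set_bij (init x) I f
    & {in init x &, {mono f : y z / y < z}}.

Definition level I : set T := [set x | has_height x I].

Definition tree :=
  [/\ forall x, wo_chain (<=%O : rel T) [in init x],
      forall a : K, level (init a) !=set0 /\ small K (level (init a))
    & level [set: K] = set0].

(* The last two clauses say that {ht(x) | x in B} = I. *)
Definition branch I B :=
  [/\ total_on B (fun x y => x <= y),
      forall x, B x -> exists2 a, I a & has_height x (init a)
    & forall a, I a -> exists2 x, B x & has_height x (init a)].

Definition vanishing B := ~ exists y, forall x, B x -> x <= y.

Definition full :=
  forall a : K, limit_ordinal a ->
    is_subset1 [set B | branch (init a) B /\ vanishing B].

Definition antichain X := forall x y, X x -> X y -> x != y -> x >< y.

Definition souslin :=
  [/\ tree, forall B, ~ branch [set: K] B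
    & forall X, antichain X -> ~ (X #= [set: K])].

End Trees.

Arguments regular_uncountable_cardinal {d} K.
Arguments subtle {d} K.
Arguments box_minus {d} K.
Arguments full {d} K {d'} T.
Arguments souslin {d} K {d'} T.

(* Main.v *)
From HB Require Import structures.
Require Import Defs.
From mathcomp Require Import all_boot all_order.
From mathcomp Require Import all_classical wochoice.

(* Nodes of height a are coded by subsets of a, ordered by end-extension.  Given
   H, a set of ordinals, and a guessing sequence W, a tree is built in which every
   node below a limit level a has a canonical extension to level a, obtained by
   walking along C_a: at a successor point t of C_a lying in H the walk moves to a
   node of level t meeting the set guessed by W_t, if there is one; at all other
   points it extends canonically.  Coherence makes the walks agree with each other.
   Level a receives all branches through the earlier levels except for at most one,
   a noncanonical one, so every such tree is a full kappa-tree.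

   Suppose that none of them is Souslin.  Then each has a dense family A of nodes
   avoided by some path to any given level.  Take trees T_0, T_1, ... with families
   A_n, where H_(n+1) consists of the points of H_n at which A_n is guessed
   correctly; subtlety gives a diamond sequence guessing all the A_n at once.  If a
   walk in T_n passes through t in H_n and still avoids A_n, then t is not in
   H_(n+1), so it is inactive in all the later trees.  Hence, past a point c for
   which C_c has enough points with correct guesses, it cannot happen that for
   every n some canonical extension from below c avoids A_n.  So for club many a of
   uncountable cofinality there is n such that all canonical extensions to level a
   meet A_n, while some node of level a avoids A_n; this node is noncanonical,
   hence T_n omits a branch Z_a at level a.  By subtlety there are b < a with the
   same n and with Z_b = Z_a restricted to b; but restrictions of Z_a belong to
   T_n, whereas Z_b does not. *)

Set Implicit Arguments.
Unset Strict Implicit.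
Unset Printing Implicit Defensive.

Import Order.TTheory.
Local Open Scope card_scope.
Local Open Scope order_scope.
Local Open Scope classical_set_scope.

(** * Well-founded recursion and regularity *)

Section Recursion.
Variables (d : Order.disp_t) (K : orderType d).

Definition below (R : Type) (r0 : R) (f : K -> R) (a : K) : K -> R :=
  fun y => if y < a then f y else r0.

(* A solution of the recursion equation, chosen classically so that the
   definition does not mention a proof of well-foundedness. *)
Definition wfrec (R : choiceType) (r0 : R) (Phi : K -> (K -> R) -> R) : K -> R :=
  xget (fun=> r0) [set f : K -> R | forall a, f a = Phi a (below r0 f a)].

Hypothesis wo : well_order (<=%O : rel K).

Lemma wo_min (A : set K) : A !=set0 -> exists2 m, A m & forall y, A y -> m <= y.
Proof.
move=> [x Ax].
have [|z [[zA zmin] _]] := wo (A := [in A]); first by exists x; rewrite inE.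
exists z; first by move: zA; rewrite inE.
by move=> y Ay; apply: zmin; rewrite inE.
Qed.

Lemma lt_ind (P : K -> Prop) :
  (forall a, (forall b, b < a -> P b) -> P a) -> forall a, P a.
Proof.
move=> IH a; apply: contrapT => nPa.
have [m nPm mmin] := wo_min (ex_intro [set x | ~ P x] a nPa).
apply: nPm; apply: IH => b bm; apply: contrapT => /mmin.
by rewrite leNgt bm.
Qed.

Lemma lt_wf : well_founded (fun x y : K => x < y).
Proof. by elim/lt_ind => a IH; constructor. Qed.

Lemma wfrecE (R : choiceType) (r0 : R) (Phi : K -> (K -> R) -> R) a :
  wfrec r0 Phi a = Phi a (below r0 (wfrec r0 Phi) a).
Proof.
pose F := Fix lt_wf (fun _ => R) (fun a rec =>
  Phi a (fun y => if pselect (y < a) is left h then rec y h else r0)).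
have FE b : F b = Phi b (below r0 F b).
  rewrite {1}/F Fix_eq.
    congr (Phi b _); apply: funext => y; rewrite /below.
    by case: pselect => [->|/negP/negbTE->].
  move=> {}b f g fg; congr (Phi b _); apply: funext => y.
  by case: pselect.
have := @xgetPex _ (fun=> r0) [set f : K -> R | forall a, f a = Phi a (below r0 f a)].
by apply; exists F.
Qed.

Lemma below_lt (R : Type) (r0 : R) (f : K -> R) a y :
  y < a -> below r0 f a y = f y.
Proof. by rewrite /below => ->. Qed.

End Recursion.

Section Regular.
Variables (d : Order.disp_t) (K : orderType d).

Lemma regular_wo : regular_uncountable_cardinal K -> well_order (<=%O : rel K).
Proof. by case. Qed.

Hypothesis hK : regular_uncountable_cardinal K.

Let wo := regular_wo hK.

(** An unbounded sequence would have a cofinal range, to which regularity gives the cardinality of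
    [K], making [K] countable. *)
Lemma countable_bounded (f : nat -> K) : exists b, forall n, f n < b.
Proof.
case: hK => _ _ reg unc; apply: contrapT => nb; apply: unc.
have /reg/eq_countable <- : cofinal (range f).
  move=> a; apply: contrapT => na; apply: nb; exists a => n.
  by rewrite ltNge; apply/negP => an; apply: na; exists (f n) => //; exists n.
by apply: sub_countable (card_image_le _ _) _.
Qed.

Lemma exists_gt (a : K) : exists b, a < b.
Proof. by have [b ab] := countable_bounded (fun=> a); exists b; apply: ab 0. Qed.

Lemma image_bounded a (f : K -> K) : exists b, forall x, x < a -> f x < b.
Proof.
case: hK => _ sm reg _; apply: contrapT => nb.
have /reg/card_eqPle[_ le] : cofinal (f @` init a).
  move=> b; apply: contrapT => na; apply: nb; exists b => x xa.
  by rewrite ltNge; apply/negP => bx; apply: na; exists (f x) => //; exists x.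
have /negP := sm a; apply; exact: card_le_trans le (card_image_le _ _).
Qed.

Lemma small_bounded U (X : set U) (f : U -> K) b :
  {in X &, injective f} -> (forall x, X x -> f x < b) -> small K X.
Proof.
case: hK => _ sm _ _ fi fb; apply/negP => le.
have /negP := sm b; apply; apply: card_le_trans le _.
have /card_eqPle[_ le] := inj_card_eq fi.
apply: card_le_trans le _; apply: subset_card_le => _ [x Xx <-]; exact: fb.
Qed.

Lemma lub_seq (f : nat -> K) :
  exists b, (forall n, f n <= b) /\ forall c, c < b -> exists n, c < f n.
Proof.
have [b fb] := countable_bounded f.
have [|m fm mmin] := wo_min wo (A := [set m | forall n, f n <= m]).
  by exists b => n; apply: ltW.
exists m; split=> // c cm; apply: contrapT => nc.
suff /mmin : forall n, f n <= c by rewrite leNgt cm.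
by move=> n; rewrite leNgt; apply/negP => cn; apply: nc; exists n.
Qed.

Lemma exists_zero : exists o : K, forall a, o <= a.
Proof.
have [|m _ mmin] := wo_min wo (A := [set: K]).
  apply: contrapT => n0; case: hK => _ _ _; apply.
  have -> : [set: K] = set0 by apply/eqP/negPn/negP => /set0P.
  exact: countable0.
by exists m => a; apply: mmin.
Qed.

End Regular.

(** * Limits and clubs *)

Section Clubs.
Variables (d : Order.disp_t) (K : orderType d).
Implicit Types (a b c : K).

Lemma limit_pointP (C : set K) a : limit_point C a <->
  init a !=set0 /\ forall b, b < a -> exists c, [/\ C c, b < c & c < a].
Proof.
split=> [[a0 [_ amin]]|[a0 aC]]; split=> //.
  move=> b ba; apply: contrapT => nc.
  suff /amin : ubound (C `&` init a) b by rewrite leNgt ba.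
  move=> c [Cc ca]; rewrite leNgt; apply/negP => bc.
  by apply: nc; exists c.
split; first by move=> c [_ /ltW].
move=> b bub; rewrite leNgt; apply/negP => /aC[c [Cc bc ca]].
by move: (bub c (conj Cc ca)); rewrite leNgt bc.
Qed.

Lemma limit_ordinalP a : limit_ordinal a <->
  init a !=set0 /\ forall b, b < a -> exists2 c, b < c & c < a.
Proof.
rewrite /limit_ordinal limit_pointP; split=> -[a0 al]; split=> // b /al.
  by move=> [c [_ *]]; exists c.
by move=> [c ? ?]; exists c.
Qed.

Lemma limit_pointS (C D : set K) a :
  (forall c, c < a -> C c -> D c) -> limit_point C a -> limit_point D a.
Proof.
move=> CD /limit_pointP[a0 aC]; apply/limit_pointP; split=> // b /aC[c [Cc ? ca]].
by exists c; split=> //; apply: CD.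
Qed.

Lemma limit_point_limit (C : set K) a : limit_point C a -> limit_ordinal a.
Proof. exact: limit_pointS. Qed.

Lemma ordinal_cases a :
  [\/ init a = set0, (exists2 b, b < a & forall c, c < a -> c <= b)
    | limit_ordinal a].
Proof.
have [->|/eqP/set0P[x xa]] := pselect (init a = set0); first by constructor 1.
have [[b ba bm]|nb] := pselect (exists2 b, b < a & forall c, c < a -> c <= b).
  by constructor 2; exists b.
constructor 3; apply/limit_ordinalP; split; first by exists x.
move=> b ba; apply: contrapT => nc; apply: nb; exists b => // c ca.
by rewrite leNgt; apply/negP => bc; apply: nc; exists c.
Qed.

Hypothesis hK : regular_uncountable_cardinal K.

Let wo := regular_wo hK.

Lemma exists_succ b : exists2 a, b < a & forall c, c < a -> c <= b.
Proof.
have [x bx] := exists_gt hK b.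
have [|a ba amin] := wo_min wo (A := [set a | b < a]); first by exists x.
by exists a => // c; rewrite leNgt => ca; apply/negP => /amin; rewrite leNgt ca.
Qed.

Definition closed_under (g : K -> K) : set K :=
  [set c | limit_ordinal c /\ forall s, s < c -> g s < c].

Lemma club_closed_under (g : K -> K) : club (closed_under g).
Proof.
split; first split=> // a _ ag.
- split; first exact: limit_point_limit ag.
  move=> s sa; have /limit_pointP[_ /(_ s sa)[c [[_ cg] sc ca]]] := ag.
  exact: lt_trans (cg s sc) ca.
- move=> a.
  (* Iterating [h] from [a] and taking the supremum of the iterates yields a limit closed under
     [g]. *)
  have /choice[h hP] c : exists b, c < b /\ forall s, s < c -> g s < b.
    have [b gb] := image_bounded hK c g; have [b' cb'] := exists_gt hK c.
    exists (Order.max b b'); split=> [|s /gb sb]; first by rewrite lt_max cb' orbT.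
    by rewrite lt_max sb.
  have [b [fb bmin]] := lub_seq hK (fun n => iter n h a).
  exists b; last exact: fb 0.
  split=> [|s /bmin[n sn]]; last first.
    by apply: lt_le_trans (fb n.+1); apply: (hP _).2.
  apply/limit_ordinalP; split=> [|s /bmin[n sn]].
    by exists a; apply: lt_le_trans (fb 1); apply: (hP _).1.
  by exists (iter n h a) => //; apply: lt_le_trans (fb n.+1); apply: (hP _).1.
Qed.

Lemma club_cofinal_in (B : set K) : cofinal B ->
  exists g : K -> K, forall c s, closed_under g c -> s < c ->
    exists b, [/\ B b, s < b & b < c].
Proof.
move=> Bc; have /choice[g gP] s : exists b, B b /\ s < b.
  have [t st] := exists_gt hK s; have [b Bb tb] := Bc t.
  by exists b; split=> //; apply: lt_le_trans tb.
exists g => c s [_ cg] sc; exists (g s); case: (gP s) => ? ?; split=> //.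
exact: cg.
Qed.

End Clubs.

(** * Consequences of subtlety *)

Section Coding.
Variables (d : Order.disp_t) (K : orderType d).
Implicit Types (a b c : K).
Hypothesis hK : regular_uncountable_cardinal K.
Hypothesis sK : subtle K.

Let wo := regular_wo hK.

(** Otherwise recursion yields pairwise distinct subsets of [init b], one for each element of [K];
    subtlety on the club of ordinals above [b] makes two of them agree below a point above [b], so
    they are equal. *)
Lemma strong_limit b : exists z (h : K -> set K),
  forall U, U `<=` init b -> exists2 y, y < z & h y = U.
Proof.
apply: contrapT => nsl.
pose h := wfrec (set0 : set K) (fun a f => xget (set0 : set K)
  [set U | U `<=` init b /\ forall y, y < a -> f y <> U]).
have hP a : h a `<=` init b /\ forall y, y < a -> h y <> h a.
  rewrite {1 3}/h (wfrecE wo) -/h.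
  set P := [set U | _]; suff : P (xget set0 P).
    by move=> [? hy]; split=> // y ya; move: (hy y ya); rewrite below_lt.
  apply: xgetPex; apply: contrapT => nP; apply: nsl; exists a, h => U Ub.
  apply: contrapT => nU; apply: nP; exists U; split=> // y ya.
  by rewrite below_lt // => hU; apply: nU; exists y.
have cl : club [set a | b < a].
  split; first split=> // a _ /limit_pointP[[x xa] /(_ x xa)[c [bc _ ca]]].
    exact: lt_trans bc ca.
  move=> a; have [x bx] := exists_gt hK b; exists (Order.max a x).
    by rewrite /= lt_max bx orbT.
  by rewrite le_max lexx.
have [al [be [/= bbe bal beal /seteqP[h1 h2]]]] := sK h cl.
apply: ((hP al).2 _ beal); apply/seteqP; split=> x hx.
  by have [] := h1 x (conj hx (lt_trans ((hP be).1 _ hx) bbe)).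
by have [] := h2 x (conj hx (lt_trans ((hP al).1 _ hx) bbe)).
Qed.

Lemma set_image_bounded b (phi : set K -> K) :
  exists v, forall U, U `<=` init b -> phi U < v.
Proof.
have [z [h hP]] := strong_limit b.
have [v vP] := image_bounded hK z (phi \o h).
by exists v => U /hP[y yz <-]; apply: vP.
Qed.

(** The pair of [x] and [y] is sent to the [y]-th value of a strictly increasing function lying
    above [u x], with [u] growing fast enough to separate the blocks of distinct [x]. *)
Lemma pairing (z : K -> K) : exists k : K -> K -> K,
  (forall x y x' y', y < z x -> y' < z x' -> k x y = k x' y' -> x = x' /\ y = y')
  /\ forall b, exists v, forall x y, x < b -> y < z x -> k x y < v.
Proof.
have [o _] := exists_zero hK.
have sP u : exists s : K -> K, forall y, u < s y /\ forall y', y' < y -> s y' < s y.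
  pose s := wfrec o (fun (y : K) f => xget o
    [set v | u < v /\ forall y', y' < y -> f y' < v]).
  exists s => y; rewrite {1 3}/s (wfrecE wo) -/s.
  set P := [set v | _]; suff : P (xget o P).
    by move=> [? sy]; split=> // y' y'y; move: (sy _ y'y); rewrite below_lt.
  apply: xgetPex; have [v vP] := image_bounded hK y s; have [w uw] := exists_gt hK u.
  exists (Order.max v w); split; first by rewrite lt_max uw orbT.
  by move=> y' y'y; rewrite below_lt // lt_max vP.
have {sP}[s sP] := choice sP.
have bnd (u : K -> K) b : exists v, forall x y, x < b -> y < z x -> s (u x) y < v.
  have /choice[w wP] x : exists w, forall y, y < z x -> s (u x) y < w.
    exact: image_bounded.
  have [v vP] := image_bounded hK b w.
  by exists v => x y xb yz; apply: lt_trans (wP _ _ yz) (vP _ xb).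
pose u := wfrec o (fun (b : K) f => xget o
  [set v | forall x y, x < b -> y < z x -> s (f x) y < v]).
have uP b x y : x < b -> y < z x -> s (u x) y < u b.
  move: x y; rewrite {2}/u (wfrecE wo) -/u.
  set P := [set v | _]; suff : P (xget o P).
    by move=> Pu x y xb yz; move: (Pu x y xb yz); rewrite below_lt.
  apply: xgetPex; have [v vP] := bnd u b.
  by exists v => x y xb yz; rewrite below_lt //; apply: vP.
exists (fun x y => s (u x) y); split=> // x y x' y' yz yz' e.
have xx' : x = x'.
  case: (ltgtP x x') => // xx'.
    by have := lt_trans (uP _ _ _ xx' yz) (sP (u x') y').1; rewrite e ltxx.
  by have := lt_trans (uP _ _ _ xx' yz') (sP (u x) y).1; rewrite e ltxx.
split=> //; rewrite -xx' in e; case: (ltgtP y y') => // yy'.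
  by have := (sP (u x) y').2 _ yy'; rewrite e ltxx.
by have := (sP (u x) y).2 _ yy'; rewrite e ltxx.
Qed.

Lemma nat_embedding : exists (f : nat -> K) w, injective f /\ forall i, f i < w.
Proof.
have [o _] := exists_zero hK; have [s sP] := choice (exists_gt hK).
pose f i := iter i s o; have [w wP] := countable_bounded hK f.
exists f, w; split=> //.
have inc : {mono f : i j / (i <= j)%N >-> i <= j}.
  by apply: le_mono; apply: homo_ltn lt_trans _ => i; apply: sP.
by apply: inc_inj inc.
Qed.

(** A subset of [init b] is first replaced by an index below [z b], from the enumeration given by
    [strong_limit]; then [pairing] is applied twice. *)
Lemma coding : exists code : nat -> K -> set K -> K,
  (forall i b U i' b' U', U `<=` init b -> U' `<=` init b' ->
    code i b U = code i' b' U' -> [/\ i = i', b = b' & U = U'])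
  /\ forall a, exists v, forall i b U, b < a -> U `<=` init b -> code i b U < v.
Proof.
have [z /choice[h hP]] := choice strong_limit.
have [f [w [finj fw]]] := nat_embedding.
have [k [kinj kb]] := pairing z.
have [l [linj lb]] := pairing (fun=> w).
have /choice[idx idxP] (bU : K * set K) :
    exists y, bU.2 `<=` init bU.1 -> y < z bU.1 /\ h bU.1 y = bU.2.
  have [/hP[y yz hy]|nU] := pselect (bU.2 `<=` init bU.1); first by exists y.
  by exists (z bU.1).
exists (fun i b U => l (k b (idx (b, U))) (f i)); split=> [i b U i' b' U' Ub Ub' e|a].
  have [e1 /finj ->] := linj _ _ _ _ (fw _) (fw _) e.
  have /= [i1 h1] := idxP (b, U) Ub; have /= [i2 h2] := idxP (b', U') Ub'.
  have [bb ii] := kinj _ _ _ _ i1 i2 e1; split=> //.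
  by rewrite -h1 -h2 ii bb.
have [v vP] := kb a; have [v' vP'] := lb v; exists v' => i b U ba Ub.
by apply: vP' => //; apply: vP => //; apply: (idxP (b, U) Ub).1.
Qed.

(* Below a, the triples (i, b, X) with X a subset of b can be coded by elements of
   a whenever a is closed under a suitable function. *)
Definition agree a (P Q : nat -> K -> set K -> Prop) :=
  forall i b X, b < a -> X `<=` init b -> (P i b X <-> Q i b X).

(** Each [O a] is turned into a set of codes. Closure under [v] puts the codes of triples below [b]
    under [b], so agreement of the code sets below [b] gives agreement of the families. *)
Lemma subtle_families (g : K -> K) (O : K -> nat -> K -> set K -> Prop) :
  exists b a, [/\ closed_under g b, closed_under g a, b < a & agree b (O b) (O a)].
Proof.
have [code [cinj cb]] := coding.
have /choice[v vP] s : exists v, forall i U, U `<=` init s -> code i s U < v.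
  have [s' ss' _] := exists_succ hK s; have [v vP] := cb s'.
  by exists v => i U; apply: vP.
pose A a : set K := [set x | exists i b X,
  [/\ x = code i b X, X `<=` init b & O a i b X]].
have [a [b [[bl bg] [al ag] ba /seteqP[Aab Aba]]]] :=
  sK A (club_closed_under hK (fun s => Order.max (g s) (v s))).
exists b, a; split=> //.
- by split=> // s /bg; rewrite gt_max => /andP[].
- by split=> // s /ag; rewrite gt_max => /andP[].
have cb' i c X : c < b -> X `<=` init c -> code i c X < b.
  move=> cb1 Xc; apply: lt_trans (vP _ i X Xc) _.
  by move: (bg _ cb1); rewrite gt_max => /andP[].
move=> i c X cb1 Xc; split=> OX.
  have [|[i' [c' [X' [e Xc' OX']]]] _] := Aab (code i c X); last first.
    by have [-> -> ->] := cinj _ _ _ _ _ _ Xc Xc' e.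
  by split; [exists i, c, X|apply: cb'].
have [|[i' [c' [X' [e Xc' OX']]]] _] := Aba (code i c X); last first.
  by have [-> -> ->] := cinj _ _ _ _ _ _ Xc Xc' e.
by split; [exists i, c, X|apply: cb'].
Qed.

(* Omega is built recursively from counterexamples to the guessing so far; two
   counterexamples identified by subtlety refute each other. *)
Lemma diamond : exists Omega : K -> nat -> K -> set K -> Prop,
  forall (A : nat -> K -> set K -> Prop) (g : K -> K),
    exists2 c, closed_under g c & agree c (Omega c) A.
Proof.
pose R : choiceType := ((nat -> K -> set K -> Prop) * set K)%type.
pose r0 : R := (fun _ _ _ => False, set0).
(* A candidate is a family together with a set closed and unbounded in [a], no point of which below
   [a] guesses the family correctly. *)
pose cand a (f : K -> R) := [set r : R |
  [/\ limit_point r.2 a, forall y, y < a -> limit_point r.2 y -> r.2 y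
    & forall y, r.2 y -> y < a -> ~ agree y (f y).1 r.1]].
pose F := wfrec r0 (fun a f => xget r0 (cand a f)).
exists (fun a => (F a).1) => A g; apply: contrapT => nc.
pose E : set K := closed_under g.
have [[_ Ecl] Ecof] := club_closed_under hK g.
have [g' g'P] := club_cofinal_in hK Ecof.
have FP a : limit_point E a -> cand a F (F a).
  move=> Ea; rewrite {2}/F (wfrecE wo) -/F.
  set f := below _ _ _; suff : cand a f (xget r0 (cand a f)).
    move=> [? ? H]; split=> // y Ey ya.
    by move: (H y Ey ya); rewrite /f below_lt.
  apply: xgetPex; exists (A, E); split=> [//|y _|y Ey ya /=].
    exact: Ecl.
  by rewrite /f below_lt // => ag; apply: nc; exists y.
(* Index 0 carries the closed set and index [j.+1] the [j]-th predicate, so that subtlety matches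
   both at once. *)
have [b [a [bg ag ba agr]]] := subtle_families g' (fun c i b X =>
  if i is j.+1 then (F c).1 j b X else (F c).2 b).
have lp c : closed_under g' c -> limit_point E c.
  move=> cg; apply/limit_pointP; have /limit_ordinalP[? _] := cg.1.
  by split=> // x xc; apply: g'P.
have [Fb1 _ _] := FP b (lp b bg); have [_ Fa2 Fa3] := FP a (lp a ag).
have Eb : (F a).2 b.
  apply: Fa2 => //; apply: limit_pointS Fb1 => c cb Ec.
  by apply/(agr 0 c set0).
by apply: (Fa3 b Eb ba) => i c X cb Xc; apply: (agr i.+1).
Qed.

End Coding.

(** * Trees with canonical extensions *)

Section TreeDef.
Variables (d : Order.disp_t) (K : orderType d).
Variables (C : K -> set K) (H : set K) (W : K -> K -> set K -> Prop).
Implicit Types (a b m s t : K) (D X Y Z U : set K).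

Definition hits a Y := exists2 b, b < a & W a b (Y `&` init b).

(* s is the predecessor of t in D restricted to the points after m, or m itself if
   t is the first such point. *)
Definition gap D m t s :=
  [/\ s < t, s = m \/ D s /\ m < s & forall u, D u -> u < t -> u <= s].

Section Walk.
Variables (L : K -> set (set K)) (E : K -> K -> set K -> set K).

Definition step t s U : set K :=
  xget (E t s U) [set Y | [/\ H t, L t Y, Y `&` init s = U & hits t Y]].

Definition walk_union D m X (f : K -> set K) t : set K :=
  X `|` [set x | exists t', [/\ D t', m < t', t' < t & f t' x]].

(* For D = C a, the path towards level a starting with the node X of level m; its
   value at a itself is the canonical extension. *)
Definition walk D m X : K -> set K :=
  wfrec (set0 : set K) (fun t f =>
    let U := walk_union D m X f t in
    if pselect (exists s, gap D m t s) then step t (xget t (gap D m t)) U else U).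

Definition branches a : set (set K) :=
  [set X | X `<=` init a /\ forall b, b < a -> L b (X `&` init b)].

Definition noncanonical a (Ea : K -> set K -> set K) : set (set K) :=
  [set Z | branches a Z /\ forall m X, m < a -> L m X -> Z <> Ea m X].

(** Membership in [noncanonical a Ea] guards against the default of [xget]: without a noncanonical
    branch nothing is removed, not even [set0]. *)
Definition level_of a Ea : set (set K) :=
  branches a `\` [set Z | limit_ordinal a /\ noncanonical a Ea Z
                          /\ Z = xget set0 (noncanonical a Ea)].

(* The xget term denotes the predecessor of a successor a. *)
Definition ext_of a m X : set K :=
  if m < a then
    if pselect (limit_ordinal a) then walk (C a) m X a
    else E (xget a [set b | b < a /\ forall c, c < a -> c <= b]) m X
  else X.

End Walk.

Definition tree_data : K -> set (set K) * (K -> set K -> set K) :=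
  wfrec ((set0, fun _ => id) : set (set K) * (K -> set K -> set K)) (fun a f =>
    let L b := (f b).1 in let E b := (f b).2 in
    (level_of L a (ext_of L E a), ext_of L E a)).

Definition lev a := (tree_data a).1.
Definition ext a := (tree_data a).2.

End TreeDef.

(** * Walks along [C a] and the recursion equations of the tree *)

Section TreeTheory.
Variables (d : Order.disp_t) (K : orderType d).
Hypothesis hK : regular_uncountable_cardinal K.
Variables (C : K -> set K) (H : set K) (W : K -> K -> set K -> Prop).
Implicit Types (a b m s t : K) (D X Y Z U : set K).

Let wo := regular_wo hK.

Lemma gap_congr D D' m t : (forall u, u < t -> D u <-> D' u) ->
  gap D m t = gap D' m t.
Proof.
suff gapS D1 D2 s : (forall u, u < t -> D1 u <-> D2 u) ->
    gap D1 m t s -> gap D2 m t s.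
  by move=> DD'; apply/funext => s; apply/propext; split; apply: gapS => // u /DD' [].
move=> DD [st sm Dt]; split=> // [|u Du ut]; last by apply: Dt; rewrite ?DD.
by case: sm => [|[/(DD _ st)]]; [left|right].
Qed.

Lemma gap_uniq D m t s s' : gap D m t s -> gap D m t s' -> s = s'.
Proof.
move=> [st [->|[Ds ms]] Dt] [s't [->|[Ds' ms']] Dt'] //.
- by move: (Dt _ Ds' s't); rewrite leNgt ms'.
- by move: (Dt' _ Ds st); rewrite leNgt ms.
- by apply/eqP; rewrite eq_le Dt // Dt'.
Qed.

(** The least upper bound [s] of [m] and the points of [D] below [t] stays below [t]; if [s] exceeds
    [m], it lies in [D] by closure. *)
Lemma gap_exists D m t : m < t -> (forall s, s < t -> limit_point D s -> D s) ->
  ~ limit_point D t -> exists s, gap D m t s.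
Proof.
move=> mt Dcl nl.
have [b bt Db] : exists2 b, b < t & forall u, D u -> u < t -> u <= b.
  apply: contrapT => nb; apply: nl; apply/limit_pointP; split; first by exists m.
  move=> b bt; apply: contrapT => nc; apply: nb; exists b => // u Du ut.
  by rewrite leNgt; apply/negP => bu; apply: nc; exists u.
pose ub u := m <= u /\ forall v, D v -> v < t -> v <= u.
have [|s [ms sub] smin] := wo_min wo (A := ub).
  exists (Order.max m b); split; first by rewrite le_max lexx.
  by move=> v Dv vt; rewrite le_max Db // orbT.
have st : s < t.
  apply: le_lt_trans (smin (Order.max m b) _) _; last by rewrite gt_max mt.
  split; first by rewrite le_max lexx.
  by move=> v Dv vt; rewrite le_max Db // orbT.
exists s; split=> //.
move: ms; rewrite le_eqVlt => /predU1P[->|ms]; first by left.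
right; split=> //; apply: contrapT => nDs; apply/nDs/Dcl => //.
apply/limit_pointP; split; first by exists m.
move=> u us; apply: contrapT => nv.
have /smin : ub (Order.max m u).
  split; first by rewrite le_max lexx.
  move=> v Dv vt; rewrite leNgt; apply/negP; rewrite gt_max => /andP[mv uv].
  apply: nv; exists v; split=> //; rewrite lt_neqAle sub // andbT.
  by apply/eqP => vs; apply: nDs; rewrite -vs.
by rewrite leNgt gt_max ms us.
Qed.

Section WalkTheory.
Variables (L : K -> set (set K)) (E : K -> K -> set K -> set K).
Local Notation walkLE := (walk H W L E).

Lemma walk_union_congr D D' m X f f' t : (forall u, u < t -> D u <-> D' u) ->
  (forall u, D u -> u < t -> f u = f' u) ->
  walk_union D m X f t = walk_union D' m X f' t.
Proof.
move=> DD' ff'; congr (_ `|` _); apply/seteqP; split=> x [u [Du mu ut fu]].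
  by exists u; split; rewrite -?DD' -?ff'.
by have Du' := (DD' _ ut).2 Du; exists u; split; rewrite ?ff'.
Qed.

Lemma walkE D m X t : walkLE D m X t =
  if pselect (exists s, gap D m t s)
  then step H W L E t (xget t (gap D m t)) (walk_union D m X (walkLE D m X) t)
  else walk_union D m X (walkLE D m X) t.
Proof.
rewrite {1}/walk (wfrecE wo) -/(walkLE D m X).
rewrite (@walk_union_congr D D m X _ (walkLE D m X)) // => u _ ut.
by rewrite below_lt.
Qed.

Lemma walk_nogap D m X t : (forall s, ~ gap D m t s) ->
  walkLE D m X t = walk_union D m X (walkLE D m X) t.
Proof. by move=> ng; rewrite walkE; case: pselect => // -[s g]; case: (ng s g). Qed.

Lemma walk_gap D m X t s : gap D m t s ->
  walkLE D m X t = step H W L E t s (walk_union D m X (walkLE D m X) t).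
Proof.
move=> g; rewrite walkE; case: pselect => [?|[]]; last by exists s.
by rewrite (gap_uniq (xgetPex t (ex_intro _ s g)) g).
Qed.

End WalkTheory.

(** [L] and [E] are read only at points with a gap. This transfers walks between [C a] and [C b] by
    coherence, and between truncated and complete tree data. *)
Lemma walk_congr L L' E E' D D' m X t : (forall u, u < t -> D u <-> D' u) ->
  (forall u s, u <= t -> D u \/ u = t -> gap D m u s -> L u = L' u /\ E u = E' u) ->
  walk H W L E D m X t = walk H W L' E' D' m X t.
Proof.
elim/(lt_ind wo): t => t IH DD' LE.
have e : walk_union D m X (walk H W L E D m X) t =
         walk_union D' m X (walk H W L' E' D' m X) t.
  apply: walk_union_congr => // u Du ut; apply: IH => // [v vu|v s vu Dv].
    exact/DD'/(lt_trans vu).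
  apply: LE; first exact: le_trans (ltW ut).
  by left; case: Dv => // ->.
have [[s g]|ng] := pselect (exists s, gap D m t s); last first.
  rewrite !walk_nogap // => s g; apply: ng; exists s => //.
  by rewrite (gap_congr _ DD').
rewrite (walk_gap _ _ _ g) (@walk_gap L' E' D' _ _ _ s) -?(gap_congr _ DD') // e.
have [||LL EE] := LE _ _ _ _ g => //; first by right.
by rewrite /step LL EE.
Qed.

Hypothesis CsK : C_sequence C.
Hypothesis CcK : coherent C.

Lemma Cs_sub a u : C a u -> u < a.
Proof. by have [[Csub _] _] := CsK a; apply: Csub. Qed.

Lemma Cs_closed a b : b < a -> limit_point (C a) b -> C a b.
Proof. by have [[_ Ccl] _] := CsK a; apply: Ccl. Qed.

Lemma Cs_limit a : limit_ordinal a -> limit_point (C a) a.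
Proof.
move=> [a0 al]; split=> //; have [_ Csup] := CsK a.
have -> : (C a `&` init a) = C a by apply/setIidPl => u; apply: Cs_sub.
have : supremums (C a) a.
  by rewrite Csup; move: al; rewrite setTI => -[? ?]; split.
by case=> ? amin; split.
Qed.

(** The cut-off [b'] supplied by coherence cannot lie below [b], since [C b] is cofinal in [b]. *)
Lemma Cs_coherent a b : b < a -> limit_point (C a) b ->
  forall u, u < b -> C b u <-> C a u.
Proof.
move=> ba lb u ub; have Cb := Cs_closed ba lb.
have [b' CE] := CcK ba (conj Cb lb).
rewrite CE; split=> [[]//|Cu]; split=> //.
rewrite /init /= ltNge; apply/negP => b'u.
have /limit_pointP[_ /(_ u ub)[v [Cv uv vb]]] := Cs_limit (limit_point_limit lb).
by move: Cv; rewrite CE => -[_] /= vb'; move: (lt_trans uv vb'); rewrite ltNge b'u.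
Qed.

Lemma no_gap D m t s : limit_point D t -> ~ gap D m t s.
Proof.
move=> /limit_pointP[_ lt] [st _ Ds]; have [u [Du su ut]] := lt _ st.
by move: (Ds _ Du ut); rewrite leNgt su.
Qed.

Local Notation L := (lev C H W).
Local Notation E := (ext C H W).

Lemma tree_dataE a : tree_data C H W a =
  let r := below (set0, fun _ => id) (tree_data C H W) a in
  (level_of (fun b => (r b).1) a (ext_of C H W (fun b => (r b).1) (fun b => (r b).2) a),
   ext_of C H W (fun b => (r b).1) (fun b => (r b).2) a).
Proof. by rewrite {1}/tree_data (wfrecE wo). Qed.

Lemma pred_xget a b : b < a -> (forall c, c < a -> c <= b) ->
  xget a [set b | b < a /\ forall c, c < a -> c <= b] = b.
Proof.
move=> ba bm; case: xgetP => [c _ [ca cm]|/(_ b)]; last by case.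
by apply/eqP; rewrite eq_le bm // cm.
Qed.

Lemma succ_not_limit a b : b < a -> (forall c, c < a -> c <= b) -> ~ limit_ordinal a.
Proof.
move=> ba bm /limit_ordinalP[_ /(_ b ba)[c bc /bm]].
by rewrite leNgt bc.
Qed.

Lemma extE a : E a = ext_of C H W L E a.
Proof.
rewrite /ext tree_dataE /=; set r := below _ _ _.
have rE b : b < a -> r b = tree_data C H W b by move=> ba; rewrite /r below_lt.
apply/funext => m; apply/funext => X; rewrite /ext_of; case: ifP => // ma.
case: pselect => [al|nl].
  (* A limit point of [C a] has no gap, so the walk evaluated at [a] itself never reads level [a],
     where the recursion has only default data. *)
  apply: walk_congr => // u s ua Cu g; rewrite rE //.
  case: Cu => [/Cs_sub//|e]; case: (no_gap (Cs_limit al) (s := s) (m := m)).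
  by subst u.
case: (ordinal_cases a) => // [a0|[b ba bm]].
  by have : init a m by []; rewrite a0.
by rewrite (pred_xget ba bm) rE.
Qed.

Lemma levE a : L a = level_of L a (E a).
Proof.
rewrite /lev /ext tree_dataE /=; set r := below _ _ _.
have rE b : b < a -> r b = tree_data C H W b by move=> ba; rewrite /r below_lt.
set Ea := ext_of _ _ _ _ _ _.
have Br : branches (fun b => (r b).1) a = branches L a.
  rewrite eqEsubset; split=> X [Xa Xb]; split=> // b ba.
    by move: (Xb b ba); rewrite rE.
  by rewrite rE //; apply: Xb.
have NC : noncanonical (fun b => (r b).1) a Ea = noncanonical L a Ea.
  rewrite eqEsubset /noncanonical Br; split=> X [Xa Xb]; split=> // m Y ma.
    by move: (Xb m Y ma); rewrite rE.
  by rewrite rE //; apply: Xb.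
by rewrite /level_of Br NC.
Qed.

Lemma ext_id a X : E a a X = X.
Proof. by rewrite extE /ext_of ltxx. Qed.

Lemma ext_succ a b m X : b < a -> (forall c, c < a -> c <= b) -> m <= b ->
  E a m X = E b m X.
Proof.
move=> ba bm mb; rewrite extE /ext_of (le_lt_trans mb ba) (pred_xget ba bm).
by case: pselect => // al; case: (succ_not_limit ba bm al).
Qed.

Lemma ext_limit a m X : limit_ordinal a -> m < a ->
  E a m X = walk H W L E (C a) m X a.
Proof. by move=> al ma; rewrite extE /ext_of ma; case: pselect. Qed.

End TreeTheory.

(** * Levels, omitted branches and canonical extensions *)

Section Levels.
Variables (d : Order.disp_t) (K : orderType d).
Hypothesis hK : regular_uncountable_cardinal K.
Variables (C : K -> set K) (H : set K) (W : K -> K -> set K -> Prop).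
Hypotheses (CsK : C_sequence C) (CcK : coherent C).
Implicit Types (a b m s t : K) (D X Y Z U : set K).

Let wo := regular_wo hK.

Local Notation L := (lev C H W).
Local Notation E := (ext C H W).

Lemma setI_init X a b : b <= a -> X `&` init a `&` init b = X `&` init b.
Proof.
move=> ba; apply/seteqP; split=> x; first by case=> -[].
by case=> Xx xb; split=> //; split=> //; apply: lt_le_trans ba.
Qed.

Lemma setI_initl X a : X `<=` init a -> X `&` init a = X.
Proof. by move=> Xa; apply/setIidPl. Qed.

Lemma lev_branch a X : L a X -> branches L a X.
Proof. by rewrite {1}(levE hK) => -[]. Qed.

Lemma lev_sub a X : L a X -> X `<=` init a.
Proof. by move=> /lev_branch[]. Qed.

Lemma lev_restrict a b X : b <= a -> L a X -> L b (X `&` init b).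
Proof.
rewrite le_eqVlt => /predU1P[->|ba LX]; last by have [_] := lev_branch LX; apply.
by move=> LX; rewrite (setI_initl (lev_sub LX)).
Qed.

Lemma lev_nonlimit a X : ~ limit_ordinal a -> branches L a X -> L a X.
Proof. by move=> nl BX; rewrite (levE hK); split=> // -[]. Qed.

Lemma omitted_uniq a X Y :
  branches L a X -> ~ L a X -> branches L a Y -> ~ L a Y -> X = Y.
Proof.
move=> BX; rewrite (levE hK) => nX BY nY.
have [_ [_ ->]] : [set Z | limit_ordinal a /\ noncanonical L a (E a) Z /\
   Z = xget set0 (noncanonical L a (E a))] X by apply: contrapT => nX'; apply: nX.
have [_ [_ ->]] : [set Z | limit_ordinal a /\ noncanonical L a (E a) Z /\
   Z = xget set0 (noncanonical L a (E a))] Y by apply: contrapT => nY'; apply: nY.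
by [].
Qed.

Lemma ext_in_lev a m X : m < a -> L m X -> branches L a (E a m X) -> L a (E a m X).
Proof.
move=> ma LX BE; rewrite (levE hK); split=> // -[_ [[_ N] _]].
exact: N ma LX erefl.
Qed.

(** [X] itself may survive in level [a]; it shows that [noncanonical] is nonempty, so that the
    branch selected by [xget] is noncanonical and hence removed. *)
Lemma branches_omitted a X : branches L a X ->
  (forall m Y, m < a -> L m Y -> X <> E a m Y) -> limit_ordinal a ->
  exists2 Z, branches L a Z & ~ L a Z.
Proof.
move=> BX NX al.
have [BZ NZ] : noncanonical L a (E a) (xget set0 (noncanonical L a (E a))).
  by apply: xgetPex; exists X.
exists (xget set0 (noncanonical L a (E a))) => //.
by rewrite {1}(levE hK) => -[_]; apply.
Qed.

Definition ext_spec a := forall m X, m <= a -> L m X ->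
  L a (E a m X) /\ E a m X `&` init m = X.

Section Walks.
Variables (a m : K) (X : set K).
Hypotheses (IH : forall b, b < a -> ext_spec b) (al : limit_ordinal a).
Hypotheses (ma : m < a) (LX : L m X).

Local Notation w := (walk H W L E (C a) m X).

Lemma walk_spec t : m < t -> C a t \/ t = a ->
  [/\ w t `<=` init t, w t `&` init m = X,
      forall u, C a u -> m < u -> u < t -> w t `&` init u = w u,
      t < a -> L t (w t)
    & forall s, gap (C a) m t s ->
        L s (w t `&` init s) /\ w t = step H W L E t s (w t `&` init s)].
Proof.
elim/(lt_ind wo): t => t IHt mt Ct.
have ta : t <= a by case: Ct => [/(Cs_sub CsK)/ltW|->].
have [lt|nlt] := pselect (limit_point (C a) t).
  have wE : w t = walk_union (C a) m X w t.
    by rewrite walk_nogap // => s; apply: no_gap.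
  have wm : w t `&` init m = X.
    rewrite wE; apply/seteqP; split=> x; last first.
      by move=> Xx; split; [left|apply: lev_sub LX _ Xx].
    case=> -[//|[u [Cu mu ut wx]] xm].
    by have [_ <-] := IHt u ut mu (or_introl Cu).
  have wu u : C a u -> m < u -> u < t -> w t `&` init u = w u.
    move=> Cu mu ut; have [wu wum wuv _ _] := IHt u ut mu (or_introl Cu).
    rewrite {1}wE; apply/seteqP; split=> x; last first.
      by move=> wx; split; [right; exists u|apply: wu].
    case=> -[Xx|[v [Cv mv vt wx]] xu].
      by have [] : (w u `&` init m) x by rewrite wum.
    have [uv|vu|->//] := ltgtP u v.
      have [_ _ /(_ u Cu mu uv) <-] := IHt v vt mv (or_introl Cv).
      by split.
    by have [] : (w u `&` init v) x by rewrite wuv.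
  split=> //.
  - rewrite wE => x [Xx|[u [Cu mu ut wx]]].
      exact: lt_trans (lev_sub LX Xx) mt.
    by have [+ _ _ _ _] := IHt u ut mu (or_introl Cu) => /(_ x wx)/lt_trans; apply.
  (* By coherence the walk arriving at [t] is the canonical extension to [t], which the hypothesis
     [IH] places in level [t]. *)
  - move=> ta'; have -> : w t = E t m X.
      rewrite ext_limit //; last exact: limit_point_limit lt.
      apply: walk_congr => // u ut; symmetry; exact: Cs_coherent.
    by apply: (IH ta' (ltW mt) LX).1.
  - by move=> s /(no_gap lt).
have {}ta : t < a.
  by rewrite lt_neqAle ta andbT; apply/eqP => e; apply: nlt; rewrite e; apply: Cs_limit.
have {Ct}Ct : C a t by case: Ct => // e; rewrite e ltxx in ta.
have [|s g] := gap_exists hK mt _ nlt.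
  by move=> s st; apply: Cs_closed; rewrite ?(lt_trans st).
have [st sm Ds] := g; rewrite (walk_gap hK _ _ _ _ _ g).
pose U := walk_union (C a) m X w t.
have [LU UE] : L s U /\ forall u, C a u -> m < u -> u < t -> U `&` init u = w u.
  case: sm => [e|[Cs ms]].
    have -> : U = X.
      apply/seteqP; split=> x; last by left.
      by case=> // -[u [Cu mu /(Ds _ Cu)]]; rewrite e leNgt mu.
    by rewrite e; split=> // u Cu mu /(Ds _ Cu); rewrite e leNgt mu.
  have [ws wsm wsu wsL _] := IHt s st ms (or_introl Cs).
  have -> : U = w s.
    apply/seteqP; split=> x; last by right; exists s.
    case=> [Xx|[u [Cu mu ut wx]]].
      by have [] : (w s `&` init m) x by rewrite wsm.
    have [us|su|<-//] := ltgtP u s; last by move: (Ds _ Cu ut); rewrite leNgt su.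
    by have [] : (w s `&` init u) x by rewrite wsu.
  split=> [|u Cu mu ut]; first by apply: wsL; apply: lt_trans ta.
  have := Ds _ Cu ut; rewrite le_eqVlt => /predU1P[->|us]; last exact: wsu.
  exact: setI_initl.
have ms : m <= s by case: sm => [->|[_ /ltW]].
have Um : U `&` init m = X.
  apply/seteqP; split=> x; last by move=> Xx; split; [left|apply: lev_sub LX _ Xx].
  case=> -[//|[u [Cu mu ut wx]] xm].
  by have [_ <-] := IHt u ut mu (or_introl Cu).
set V := step _ _ _ _ _ _ _.
have [LV VU] : L t V /\ V `&` init s = U.
  rewrite /V /step; case: xgetP => [Y _ [] //|_].
  exact: IH (ltW st) LU.
split=> //; first exact: lev_sub LV.
- by rewrite -(setI_init _ ms) VU.
- by move=> u Cu mu ut; rewrite -(setI_init _ (Ds _ Cu ut)) VU; apply: UE.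
- by move=> s' /(gap_uniq g) <-; rewrite VU.
Qed.

(** The value at [a] is a branch since its restrictions to points of [C a] above [m] are nodes;
    being canonical, it is not omitted. *)
Lemma walk_top : L a (w a) /\ w a `&` init m = X.
Proof.
have [wa wm wu _ _] := walk_spec ma (or_intror erefl); split=> //.
have /limit_pointP[_ la] := Cs_limit CsK al.
rewrite -(ext_limit hK) //; apply: ext_in_lev => //; rewrite (ext_limit hK) //.
split=> // b ba; have bma : Order.max b m < a by rewrite gt_max ba.
have [u [Cu]] := la _ bma; rewrite gt_max => /andP[bu mu] ua.
rewrite -(setI_init _ (ltW bu)) wu //; apply: lev_restrict (ltW bu) _.
by have [_ _ _ + _] := walk_spec mu (or_introl Cu); apply.
Qed.

End Walks.

Lemma ext_correct a : ext_spec a.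
Proof.
elim/(lt_ind wo): a => a IH m X; rewrite le_eqVlt => /predU1P[<-|ma] LX.
  rewrite ext_id //; split=> //; exact/setI_initl/lev_sub.
have [a0|[b ba bm]|al] := ordinal_cases a.
- by have : init a m by []; rewrite a0.
- have [LE EX] := IH b ba m X (bm m ma) LX.
  rewrite (ext_succ hK _ _ CsK _ ba bm (bm m ma)).
  split=> //; apply: lev_nonlimit; first exact: succ_not_limit ba bm.
  split=> [x /(lev_sub LE) xb|c /bm cb]; first exact: lt_trans xb ba.
  exact: lev_restrict LE.
- by rewrite ext_limit //; apply: walk_top.
Qed.

Lemma ext_lev a m X : m <= a -> L m X -> L a (E a m X).
Proof. by move=> ma LX; have [] := ext_correct ma LX. Qed.

Lemma ext_restrict a m X : m <= a -> L m X -> E a m X `&` init m = X.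
Proof. by move=> ma LX; have [] := ext_correct ma LX. Qed.

Lemma ext_acc a b m X : limit_ordinal a -> b < a -> limit_point (C a) b ->
  m < b -> L m X -> E a m X `&` init b = E b m X.
Proof.
move=> al ba lb mb LX; have ma := lt_trans mb ba.
have IH c : c < a -> ext_spec c by move=> _; apply: ext_correct.
have [_ _ wu _ _] := walk_spec IH al LX ma (or_intror erefl).
rewrite (ext_limit hK) // wu //; last exact: Cs_closed.
rewrite ext_limit //; last exact: limit_point_limit lb.
by apply: walk_congr => // u ub; symmetry; apply: Cs_coherent.
Qed.

Lemma ext_gap a m t s X : limit_ordinal a -> m < t -> C a t -> L m X ->
  gap (C a) m t s ->
  L s (E a m X `&` init s) /\
  E a m X `&` init t = step H W L E t s (E a m X `&` init s).
Proof.
move=> al mt Ct LX g; have ta := Cs_sub CsK Ct; have ma := lt_trans mt ta.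
have IH c : c < a -> ext_spec c by move=> _; apply: ext_correct.
have [_ _ wu _ _] := walk_spec IH al LX ma (or_intror erefl).
have [_ _ _ _ /(_ s g)] := walk_spec IH al LX mt (or_introl Ct).
by rewrite (ext_limit hK) // -(wu _ Ct mt ta) setI_init //; case: g => /ltW.
Qed.

End Levels.

(** * The order of nodes, heights and branches *)

Section Nodes.
Variables (d : Order.disp_t) (K : orderType d) (P : K -> set (set K)).

Record node := Node {
  node_height : K;
  trace : set K;
  trace_sub : trace `<=` init node_height;
  trace_lev : P node_height trace }.

HB.instance Definition _ := gen_eqMixin node.
HB.instance Definition _ := gen_choiceMixin node.

Local Notation ht := node_height.

Lemma node_eq (x y : node) : ht x = ht y -> trace x = trace y -> x = y.
Proof.
case: x y => [a X Xa PX] [b Y Yb PY] /= ab XY.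
by subst b Y; congr Node; apply: Prop_irrelevance.
Qed.

Definition node_le (x y : node) : bool :=
  `[< ht x <= ht y /\ trace x = trace y `&` init (ht x) >].

Lemma node_le_refl : reflexive node_le.
Proof.
by move=> x; apply/asboolP; split=> //; rewrite setI_initl //; apply: trace_sub.
Qed.

Lemma node_le_anti : antisymmetric node_le.
Proof.
move=> x y /andP[/asboolP[xy XY] /asboolP[yx YX]].
have e : ht x = ht y by apply/eqP; rewrite eq_le xy.
by apply: node_eq => //; rewrite XY e setI_initl //; apply: trace_sub.
Qed.

Lemma node_le_trans : transitive node_le.
Proof.
move=> y x z /asboolP[xy XY] /asboolP[yz YZ]; apply/asboolP.
by split; [exact: le_trans yz|rewrite XY YZ setI_init].
Qed.

HB.instance Definition _ := Order.Le_isPOrder.Build (Order.Disp tt tt) node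
  node_le_refl node_le_anti node_le_trans.

Lemma leNode (x y : node) :
  x <= y <-> ht x <= ht y /\ trace x = trace y `&` init (ht x).
Proof. by split=> [/asboolP|h]; last apply/asboolP. Qed.

Lemma ltNode (x y : node) :
  x < y <-> ht x < ht y /\ trace x = trace y `&` init (ht x).
Proof.
rewrite lt_def; split=> [/andP[/eqP yx /leNode[xy XY]]|[xy XY]].
  split=> //; rewrite lt_neqAle xy andbT; apply/eqP => e; apply: yx.
  by apply: node_eq => //; rewrite XY e setI_initl //; apply: trace_sub.
apply/andP; split; last by apply/leNode; split=> //; apply: ltW.
by apply/eqP => e; rewrite e ltxx in xy.
Qed.

Hypothesis hK : regular_uncountable_cardinal K.
Hypothesis sK : subtle K.
Hypothesis P_restrict : forall a b X, b <= a -> P a X -> P b (X `&` init b).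

Let wo := regular_wo hK.

Lemma node_below (x : node) b : b < ht x -> exists2 y, y < x & ht y = b.
Proof.
move=> bx.
pose y := @Node b (trace x `&` init b) (@subIsetr _ _ _)
  (P_restrict (ltW bx) (@trace_lev x)).
by exists y => //; apply/ltNode.
Qed.

Lemma chain_le (x y z : node) : x <= z -> y <= z -> ht x <= ht y -> x <= y.
Proof.
move=> /leNode[xz XZ] /leNode[yz YZ] xy; apply/leNode; split=> //.
by rewrite YZ setI_init.
Qed.

Lemma chain_lt (x y z : node) : x <= z -> y <= z -> ht x < ht y -> x < y.
Proof.
move=> xz yz xy; rewrite lt_neqAle (chain_le xz yz (ltW xy)) andbT.
by apply/eqP => e; rewrite e ltxx in xy.
Qed.

Lemma has_height_node (x : node) : has_height x (init (ht x)).
Proof.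
exists ht.
  split=> [y /ltNode[]//|y z|b bx].
    rewrite !inE => yx zx e.
    apply/eqP; rewrite eq_le (chain_le (ltW yx) (ltW zx)) ?e //.
    by rewrite (chain_le (ltW zx) (ltW yx)) ?e.
  by have [y yx <-] := node_below bx; exists y.
move=> y z; rewrite !inE => yx zx; apply/idP/idP => [|/ltNode[]//].
exact: chain_lt (ltW yx) (ltW zx).
Qed.

(** By induction on the height, an isomorphism onto an initial segment sends each [y < x] to
    [ht y]. *)
Lemma has_height_uniq (x : node) I : (forall a b, b < a -> I a -> I b) ->
  has_height x I -> I = init (ht x).
Proof.
move=> Idown [f [fI finj fsurj] fmono].
have fE c : forall y, y < x -> ht y = c -> f y = c.
  elim/(lt_ind wo): c => c IH y yx yc; subst c.
  have [lt|gt|//] := ltgtP (f y) (ht y).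
    have [z zx zy] := node_below (lt_trans lt ((ltNode y x).1 yx).1).
    have := IH _ lt z zx zy => fz; rewrite -[in RHS]fz in zy.
    have : f z < f y.
      rewrite fmono ?inE //; apply: (chain_lt (ltW zx) (ltW yx)).
      by rewrite zy fz.
    by rewrite fz ltxx.
  have [z zx fz] := fsurj _ (Idown _ _ gt (fI y yx)).
  have zy : z < y by rewrite -fmono ?inE // fz.
  have hzy := ((ltNode z y).1 zy).1.
  by have := IH _ hzy z zx erefl; rewrite fz => e; rewrite e ltxx in hzy.
apply/seteqP; split=> b.
  by move=> /fsurj[y yx <-]; rewrite (fE _ _ yx erefl); move/ltNode: yx => [].
move=> bx; have [y yx yb] := node_below bx.
by rewrite -(fE b y yx yb); apply: fI.
Qed.

Lemma init_inj (a b : K) : init a = init b -> a = b.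
Proof.
move=> e; have [ab|ba|//] := ltgtP a b.
  by have : init b a by []; rewrite -e /init /= ltxx.
by have : init a b by []; rewrite e /init /= ltxx.
Qed.

Lemma has_height_init (x : node) a : has_height x (init a) -> ht x = a.
Proof.
by move=> /has_height_uniq e; apply/esym/init_inj/e => b c cb; apply: lt_trans.
Qed.

Lemma has_height_setT (x : node) : ~ has_height x [set: K].
Proof.
move=> /has_height_uniq e; have : [set: K] (ht x) by [].
by rewrite e // /init /= ltxx.
Qed.

(** Subtlety enters through [coding], which injects these nodes into a proper initial segment of
    [K]. *)
Lemma bounded_nodes_small (X : set node) a : (forall x, X x -> ht x < a) -> small K X.
Proof.
have [code [cinj cb]] := coding hK sK; have [v vP] := cb a.
move=> Xa; apply: (small_bounded hK (f := fun x => code 0 (ht x) (trace x)) (b := v)).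
  move=> x y _ _ e; have [_ ? ?] := cinj _ _ _ _ _ _ (@trace_sub x) (@trace_sub y) e.
  exact: node_eq.
by move=> x Xx; apply: vP; [exact: Xa|exact: trace_sub].
Qed.

Lemma node_tree : (forall a, P a !=set0) -> (forall a X, P a X -> X `<=` init a) ->
  tree K node.
Proof.
move=> Pn Psub; split=> [x|a|].
- move=> A Ax [y yA].
  have [_ [z zA <-] zmin] := wo_min wo (A := ht @` [set` A])
    (ex_intro _ _ (ex_intro2 _ _ y yA erefl)).
  have xA u : u \in A -> u <= x.
    by move=> /Ax; rewrite inE => /ltW.
  have zle u : u \in A -> z <= u.
    by move=> uA; apply: chain_le (xA _ zA) (xA _ uA) _; apply: zmin; exists u.
  exists z; split=> [//|u [uA umin]].
  by apply/eqP; rewrite eq_le zle // umin.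
- have [X PX] := Pn a; split.
    exists (Node (Psub _ _ PX) PX); exact: (has_height_node (Node (Psub _ _ PX) PX)).
  have [b ab] := exists_gt hK a.
  by apply: (bounded_nodes_small (a := b)) => x /has_height_init ->.
- by apply/seteqP; split=> // x /has_height_setT.
Qed.

Definition branch_trace (B : set node) : set K :=
  [set u | exists2 x, B x & trace x u].

Lemma branch_traceE B x : total_on B (fun x y => x <= y) -> B x ->
  branch_trace B `&` init (ht x) = trace x.
Proof.
move=> Btot Bx; apply/seteqP; split=> u.
  move=> [[y By yu] ux]; have [/leNode[xy XY]|/leNode[yx XY]] := Btot x y Bx By.
    by rewrite XY.
  by move: yu; rewrite XY => -[].
by move=> xu; split; [exists x|apply: trace_sub xu].
Qed.

Lemma branch_trace_lev (I : set K) B a : (forall b c, c < b -> I b -> I c) ->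
  branch I B -> I a -> P a (branch_trace B `&` init a).
Proof.
move=> Idown [Btot BI IB] /IB[x Bx /has_height_init <-].
by rewrite branch_traceE //; apply: trace_lev.
Qed.

Lemma branch_trace_sub a B : branch (init a) B -> branch_trace B `<=` init a.
Proof.
move=> [Btot BI IB] u [x Bx xu]; have [b ba /has_height_init xb] := BI x Bx.
by have := trace_sub xu; rewrite xb => /lt_trans; apply.
Qed.

Lemma branch_uniq (a : K) (B B' : set node) : branch (init a) B -> branch (init a) B' ->
  branch_trace B = branch_trace B' -> B `<=` B'.
Proof.
move=> [Btot BI IB] [Btot' BI' IB'] e x Bx.
have [b ba /has_height_init xb] := BI x Bx.
have [y By /has_height_init yb] := IB' b ba.
suff -> : x = y by [].
apply: node_eq; first by rewrite xb yb.
by rewrite -(branch_traceE Btot Bx) -(branch_traceE Btot' By) e xb yb.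
Qed.

End Nodes.

(** * Fullness, and what a failure of the Souslin property provides *)

Section Souslin.
Variables (d : Order.disp_t) (K : orderType d).
Hypothesis hK : regular_uncountable_cardinal K.
Hypothesis sK : subtle K.
Variables (C : K -> set K) (H : set K) (W : K -> K -> set K -> Prop).
Hypotheses (CsK : C_sequence C) (CcK : coherent C).
Implicit Types (a b m s t : K) (X Y Z U V : set K).

Local Notation L := (lev C H W).
Local Notation E := (ext C H W).
Local Notation T := (node L).
Local Notation ht := node_height.

Let L_restrict := lev_restrict hK (C := C) (H := H) (W := W).
Let L_sub a X : L a X -> X `<=` init a := lev_sub hK (X := X).

Lemma lev_nonempty a : L a !=set0.
Proof.
have [o omin] := exists_zero hK.
have io : init o = set0 by rewrite -subset0 => x; rewrite /init /= ltNge omin.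
have Lo : L o set0.
  apply: lev_nonlimit => //; first by move=> /limit_ordinalP[[x]]; rewrite io.
  by split=> // b bo; have : init o b by []; rewrite io.
by exists (E a o set0); apply: ext_lev.
Qed.

(** The trace of a vanishing branch passes through all earlier levels but is not a node of level
    [a], as such a node would bound the branch; at most one trace is omitted there. *)
Lemma node_full : full K T.
Proof.
move=> a al.
have key (B : set T) : branch (init a) B -> vanishing B ->
    branches L a (branch_trace B) /\ ~ L a (branch_trace B).
  move=> Bb Bv; have Bsub := branch_trace_sub hK L_restrict Bb; split.
    split=> // b ba; apply: (branch_trace_lev hK L_restrict _ Bb) => //.
    by move=> x y /lt_trans; apply.
  move=> LB; apply: Bv; exists (Node Bsub LB) => x Bx.
  have [Btot BI _] := Bb; have [b ba /(has_height_init hK L_restrict) xb] := BI x Bx.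
  apply/leNode; rewrite xb; split; first exact: ltW.
  by rewrite /= -xb branch_traceE.
move=> B B' [Bb Bv] [Bb' Bv'].
have [? ?] := key B Bb Bv; have [? ?] := key B' Bb' Bv'.
have e : branch_trace B = branch_trace B'.
  exact: (omitted_uniq hK (H := H) (W := W) (C := C) (a := a)).
apply/seteqP; split; apply: (branch_uniq hK L_restrict (a := a)) => //.
Qed.

(* The common content of a cofinal branch and of an antichain of size kappa. *)
Definition bad (A : K -> set K -> Prop) :=
  [/\ forall b V, A b V -> L b V,
      forall s U, L s U -> exists b V, [/\ s <= b, A b V & V `&` init s = U]
    & forall a, exists2 X, L a X & forall b, b < a -> ~ A b (X `&` init b)].

(** The family consists of the nodes off the branch. It is dense because a node [U] of level [s] on
    the branch has two extensions to the next level, [U] and [U] with [s] added, and one of them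
    leaves the branch. *)
Lemma bad_branch (B : set T) : branch [set: K] B ->
  bad (fun b V => L b V /\ V <> branch_trace B `&` init b).
Proof.
move=> Bb; pose X := branch_trace B.
have LX b : L b (X `&` init b) by apply: (branch_trace_lev hK L_restrict _ Bb).
split=> [b V []//|s U LU|a]; last first.
  by exists (X `&` init a) => // b ba [_]; rewrite setI_init // ltW.
have Us : U `&` init s = U by apply/setI_initl/L_sub.
have [e|ne] := pselect (U = X `&` init s); last by exists s, U.
have [b sb bs] := exists_succ hK s.
have Lb V : V `<=` init b -> V `&` init s = U -> L b V.
  move=> Vb VU; apply: lev_nonlimit => //; first exact: succ_not_limit sb bs.
  by split=> // c /bs cs; rewrite -(setI_init _ cs) VU; exact: L_restrict cs LU.
have Ub : U `<=` init b by move=> x /(L_sub LU) xs; apply: lt_trans sb.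
have [Xs|nXs] := pselect (X s).
  exists b, U; split=> //; first exact: ltW.
  split; first exact: Lb.
  move=> e'; have : (X `&` init b) s by [].
  by rewrite -e' => /(L_sub LU); rewrite /init /= ltxx.
have Us' : (U `|` [set s]) `&` init s = U.
  apply/seteqP; split=> x; last by move=> Ux; split; [left|apply: L_sub Ux].
  by move=> [[//|->]]; rewrite /init /= ltxx.
exists b, (U `|` [set s]); split=> //; first exact: ltW.
split; first by apply: Lb => // x [/Ub//|->].
move=> e'; apply: nXs; suff : (X `&` init b) s by case.
by rewrite -e'; right.
Qed.

(** The family consists of the nodes above a member of [A0] or incomparable with all of [A0]. As
    there are too few nodes of bounded height, some member of [A0] is higher than [a]; no node
    strictly below that member is of either kind. *)
Lemma bad_antichain (A0 : set T) : antichain A0 -> A0 #= [set: K] ->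
  bad (fun b V => exists x : T, [/\ ht x = b, trace x = V &
    (exists2 y, A0 y & y <= x) \/ (forall y, A0 y -> y >< x)]).
Proof.
move=> A0anti A0card; split.
- by move=> b V [x [<- <- _]]; apply: trace_lev.
- move=> s U LU; pose u := Node (L_sub LU) LU.
  have Us : U `&` init s = U by apply/setI_initl/L_sub.
  have [[y A0y yu]|ny] := pselect (exists2 y, A0 y & y >=< u); last first.
    exists s, U; split=> //; exists u; split=> //; right => y A0y.
    by apply/negP => yu; apply: ny; exists y.
  have [yu'|/leNode[/= sy UE]] := orP yu.
    by exists s, U; split=> //; exists u; split=> //; left; exists y.
  by exists (ht y), (trace y); split=> //; exists y; split=> //; left; exists y.
- move=> a; have [y A0y ay] : exists2 y, A0 y & a < ht y.
    apply: contrapT => ny; have [a' aa'] := exists_gt hK a.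
    have : small K A0.
      apply: (bounded_nodes_small hK sK (a := a')) => y A0y.
      apply: le_lt_trans aa'; rewrite leNgt; apply/negP => ay.
      by apply: ny; exists y.
    by move/negP; apply; move/card_eqPle: A0card => [].
  exists (trace y `&` init a); first exact: L_restrict (ltW ay) (@trace_lev _ _ _ y).
  move=> b ba [x [xb xX xA]].
  have xy : x < y.
    apply/ltNode; rewrite xb xX setI_init //; last exact: ltW.
    by split=> //; apply: lt_trans ay.
  case: xA => [[z A0z zx]|/(_ y A0y)]; last first.
    by rewrite /Order.comparable (ltW xy) orbT.
  have zy := le_lt_trans zx xy.
  have zny : z != y by apply/eqP => e; rewrite e ltxx in zy.
  by move/negP: (A0anti z y A0z A0y zny); apply; rewrite /Order.comparable (ltW zy).
Qed.

Lemma not_souslin_bad : ~ souslin K T -> exists A, bad A.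
Proof.
move=> ns; apply: contrapT => nb; apply: ns; split.
- apply: node_tree => //; exact: lev_nonempty.
- by move=> B /bad_branch Bb; apply: nb; eexists; exact: Bb.
- by move=> X Xa /(bad_antichain Xa) Bb; apply: nb; eexists; exact: Bb.
Qed.

End Souslin.

(** * Countably many trees *)

Section Bound.
Variables (d : Order.disp_t) (K : orderType d).
Hypothesis hK : regular_uncountable_cardinal K.
Hypothesis sK : subtle K.
Variables (C : K -> set K) (H : set K) (W : K -> K -> set K -> Prop).

(** One bound serves all nodes of level [s], because [set_image_bounded] applies to functions on the
    subsets of [init s]. *)
Lemma bad_bound A : bad C H W A -> exists g : K -> K, forall s U, lev C H W s U ->
  exists b V, [/\ s <= b, b < g s, A b V & V `&` init s = U].
Proof.
move=> [_ Adense _].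
suff /choice[g gP] s : exists v, forall U, lev C H W s U ->
    exists b V, [/\ s <= b, b < v, A b V & V `&` init s = U] by exists g.
have /choice[phi phiP] U : exists b, lev C H W s U ->
    exists V, [/\ s <= b, A b V & V `&` init s = U].
  have [LU|nL] := pselect (lev C H W s U); last by exists s.
  by have [b bP] := Adense s U LU; exists b.
have [v vP] := set_image_bounded hK sK s phi.
exists v => U LU; have [V [sb AV VU]] := phiP U LU.
by exists (phi U), V; split=> //; apply: vP; apply: lev_sub LU.
Qed.

Definition countable_cofinality (a : K) :=
  exists f : nat -> K, (forall n, f n < a) /\ forall b, b < a -> exists n, b < f n.

(** The range of a nondecreasing cofinal sequence works, as only finitely many of its terms lie
    below a given [b < a]. Such sets will code the ordinals of countable cofinality in the last use
    of subtlety. *)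
Lemma ladder a : limit_ordinal a -> countable_cofinality a ->
  exists R : set K, limit_point R a /\ forall b, b < a -> ~ limit_point R b.
Proof.
move=> /limit_ordinalP[a0 _] [f [fa fcof]].
pose h := fix h n := if n is m.+1 then Order.max (h m) (f m.+1) else f 0.
have fh n : f n <= h n by case: n => [|n] //=; rewrite le_max lexx orbT.
have ha n : h n < a by elim: n => [|n IH] /=; rewrite ?gt_max ?IH ?fa.
have hS n : h n <= h n.+1 by rewrite /= le_max lexx.
have hle i j : (i <= j)%N -> h i <= h j.
  elim: j => [|j IH]; first by rewrite leqn0 => /eqP->.
  by rewrite leq_eqVlt => /predU1P[->//|ij]; apply: le_trans (IH ij) (hS j).
exists (range h); split.
  apply/limit_pointP; split=> // b /fcof[n bn]; exists (h n); split=> //.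
  exact: lt_le_trans (fh n).
move=> b ba /limit_pointP[[x xb] bl]; have [n bn] := fcof b ba.
have [u ub uP] : exists2 u, u < b & forall i, (i < n)%N -> h i < b -> h i <= u.
  elim: n {bn} => [|n [u ub uP]]; first by exists x.
  have [hn|hn] := ltP (h n) b; last first.
    exists u => // i; rewrite ltnS leq_eqVlt => /predU1P[->|/uP//].
    by rewrite ltNge hn.
  exists (Order.max u (h n)); first by rewrite gt_max ub.
  move=> i; rewrite ltnS leq_eqVlt => /predU1P[-> _|/uP h1 /h1 h2].
    by rewrite le_max lexx orbT.
  by rewrite le_max h2.
have [_ [[i _ <-] ui ib]] := bl u ub.
have [iN|ni] := ltnP i n; first by move: (uP i iN ib); rewrite leNgt ui.
have := lt_le_trans bn (fh n); rewrite ltNge (le_trans (hle _ _ ni)) //.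
exact: ltW.
Qed.

End Bound.

(** * Interplay of the trees: active points, avoidance and omitted branches *)

Section Family.
Variables (d : Order.disp_t) (K : orderType d).
Hypothesis hK : regular_uncountable_cardinal K.
Hypothesis sK : subtle K.
Variables (C : K -> set K) (H : nat -> set K) (Omega : K -> nat -> K -> set K -> Prop).
Variables (A : nat -> K -> set K -> Prop) (g : nat -> K -> K) (G : set K).
Hypotheses (CsK : C_sequence C) (CcK : coherent C).
Implicit Types (a b m s t : K) (X Y Z U V : set K) (n N : nat).

Let wo := regular_wo hK.

Let W n : K -> K -> set K -> Prop := fun c => Omega c n.

Local Notation L n := (lev C (H n) (W n)).
Local Notation E n := (ext C (H n) (W n)).

Definition caught n : set K := [set c | closed_under (g n) c /\
  forall b X, b < c -> X `<=` init b -> (Omega c n b X <-> A n b X)].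

Hypothesis A_bad : forall n, bad C (H n) (W n) (A n).
Hypothesis g_bound : forall n s U, L n s U ->
  exists b V, [/\ s <= b, b < g n s, A n b V & V `&` init s = U].
Hypothesis HS : forall n, H n.+1 = H n `&` caught n.
Hypothesis G_cofinal : cofinal G.
Hypothesis G_guess : forall c m, G c -> m < c -> exists t,
  [/\ nacc (C c) t, m < t, forall n, H n t & forall n, caught n t].
Hypothesis G_limit : forall c, G c -> limit_ordinal c.

Lemma H_decr n N : (n <= N)%N -> H N `<=` H n.
Proof.
elim: N => [|N IH]; first by rewrite leqn0 => /eqP->.
rewrite leq_eqVlt => /predU1P[->//|/IH HN]; rewrite HS => t [/HN].
by [].
Qed.

Definition avoids n a Z := forall b, b < a -> ~ A n b (Z `&` init b).

Lemma avoids_restrict n a b Z : b <= a -> avoids n a Z -> avoids n b (Z `&` init b).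
Proof.
move=> ba Zav c cb; rewrite setI_init; last exact: ltW.
by apply: Zav; apply: lt_le_trans ba.
Qed.

(** As [t] is closed under [g n], [U] has an extension in the family below [t]. The canonical
    extension of that node to [t] is eligible, so the step picks a node meeting the guess, and the
    guess at [t] is correct. *)
Lemma step_hits n t s U : H n t -> caught n t -> s < t -> L n s U ->
  ~ avoids n t (step (H n) (W n) (L n) (E n) t s U).
Proof.
move=> Ht [[tl tg] tA] st LU.
rewrite /step; case: xgetP => [Y _ [_ LY _ [b bt]]|nY].
  by move=> /(tA b _ bt (@subIsetr _ _ _)) AY /(_ b bt).
have [b [V [sb bg AV VU]]] := g_bound LU.
have bt : b < t := lt_trans bg (tg s st).
have [AL _ _] := A_bad n; have LV := AL _ _ AV.
case: (nY (E n t b V)); split=> //.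
- by apply: ext_lev => //; apply: ltW.
- by rewrite -(setI_init _ sb) ext_restrict //; apply: ltW.
- exists b => //; rewrite ext_restrict //; last exact: ltW.
  by apply/tA => //; apply: lev_sub LV.
Qed.

Lemma step_outside n t s U : ~ H n t ->
  step (H n) (W n) (L n) (E n) t s U = E n t s U.
Proof. by move=> nH; rewrite /step; case: xgetP => // Y _ [] /nH. Qed.

Lemma guess_hits n c m X : G c -> m < c -> L n m X -> ~ avoids n c (E n c m X).
Proof.
move=> Gc mc LX Eav; have [t [[Ct nt] mt Ht caught_t]] := G_guess Gc mc.
have tc := Cs_sub CsK Ct; have cl := G_limit Gc.
have nlt : ~ limit_point (C c) t by move=> lt; apply: nt.
have [|s gs] := gap_exists hK mt _ nlt.
  by move=> s st; apply: Cs_closed; rewrite ?(lt_trans st).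
have [LU e] := ext_gap hK CsK CcK cl mt Ct LX gs.
have [st _ _] := gs.
apply: (step_hits (Ht n) (caught_t n) st LU); rewrite -e.
exact: avoids_restrict (ltW tc) Eav.
Qed.

(* At a node t of C a, at most one of the trees can avoid its bad family while
   t is still active, since t is then inactive for all the later trees. *)
Lemma no_uniform_avoidance a c N : G c -> c <= a ->
  ~ forall n, (N <= n)%N -> exists m X,
      [/\ m < c, L n m X & avoids n a (E n a m X)].
Proof.
elim/(lt_ind wo): a c N => a IH c N Gc.
rewrite le_eqVlt => /predU1P[<- /(_ N (leqnn N))[m [X [mc LX]]]|ca].
  exact: guess_hits.
have [a0|[b ba bm]|al] := ordinal_cases a.
- by have : init a c by []; rewrite a0.
- move=> Hn; apply: (IH b ba c N Gc (bm c ca)) => n /Hn[m [X [mc LX Eav]]].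
  exists m, X; split=> // u ub.
  have mb : m <= b by apply: le_trans (ltW mc) (bm c ca).
  rewrite -(ext_succ hK _ _ CsK _ ba bm mb).
  exact: Eav (lt_trans ub ba).
have [lc|nlc] := pselect (limit_point (C a) c).
  move=> /(_ N (leqnn N))[m [X [mc LX Eav]]].
  apply: (guess_hits (n := N) Gc mc LX); rewrite -(ext_acc hK CsK CcK al ca lc mc LX).
  exact: avoids_restrict (ltW ca) Eav.
have /limit_pointP[_ /(_ c ca)[t0 [Ct0 ct0 _]]] := Cs_limit CsK al.
(* [t] is the first point of [C a] from [c] on, so every walk starting below [c] reaches it from a
   point below [c]. *)
have [|t [Ct ct] tmin] := wo_min wo (A := [set t | C a t /\ c <= t]).
  by exists t0; split=> //; apply: ltW.
have ta := Cs_sub CsK Ct.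
have nlt : ~ limit_point (C a) t.
  move: ct; rewrite le_eqVlt => /predU1P[<-//|ct].
  move=> /limit_pointP[_ /(_ c ct)[u [Cu cu ut]]].
  by have := tmin u (conj Cu (ltW cu)); rewrite leNgt ut.
move=> Hn.
have step_at n : (N <= n)%N -> exists s U,
    [/\ s < t, s < c, L n s U & avoids n t (step (H n) (W n) (L n) (E n) t s U)].
  move=> /Hn[m [X [mc LX Eav]]].
  have mt := lt_le_trans mc ct.
  have [|s gs] := gap_exists hK mt _ nlt.
    by move=> s st; apply: Cs_closed; rewrite ?(lt_trans st).
  have [LU e] := ext_gap hK CsK CcK al mt Ct LX gs.
  have [st sm _] := gs; exists s, (E n a m X `&` init s); split=> //.
    case: sm => [->//|[Cs _]]; rewrite ltNge; apply/negP => cs.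
    by have := tmin s (conj Cs cs); rewrite leNgt st.
  by rewrite -e; apply: avoids_restrict (ltW ta) Eav.
(* If [t] is active in tree [n], avoidance shows that [t] is not caught there, which removes it from
   [H n.+1]. From [N'] on, steps at [t] are canonical extensions, so the induction hypothesis
   applies at [t]. *)
have [N' NN' HN'] : exists2 N', (N <= N')%N & forall n, (N' <= n)%N -> ~ H n t.
  have [[n [Nn Ht]]|nH] := pselect (exists n, (N <= n)%N /\ H n t); last first.
    by exists N => // n Nn Ht; apply: nH; exists n.
  exists n.+1; first exact: leq_trans Nn (leqnSn n).
  move=> n' /H_decr Hn' /Hn'; rewrite HS => -[_ caught_t].
  have [s [U [st sc LU]]] := step_at n Nn.
  exact: step_hits.
apply: (IH t ta c N' Gc ct) => n N'n.
have [s [U [st sc LU]]] := step_at n (leq_trans NN' N'n).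
rewrite step_outside; last exact: HN'.
by exists s, U.
Qed.

(** Were nothing omitted, the nodes avoiding the families would be canonical, started at levels
    [f n]; uncountable cofinality gives a point of [G] below [a] and above all [f n], against
    [no_uniform_avoidance]. *)
Lemma exists_omitted a : (forall s, s < a -> exists c, [/\ G c, s < c & c < a]) ->
  limit_ordinal a -> ~ countable_cofinality a ->
  exists n Z, branches (L n) a Z /\ ~ L n a Z.
Proof.
move=> aG al ncof; apply: contrapT => nom.
have /choice[f fP] n : exists m, m < a /\ exists X, L n m X /\ avoids n a (E n a m X).
  have [_ _ /(_ a)[X LX Xav]] := A_bad n.
  apply: contrapT => nm; apply: nom; exists n.
  have nE m Y : m < a -> L n m Y -> X <> E n a m Y.
    by move=> ma LY e; apply: nm; exists m; split=> //; exists Y; rewrite -e.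
  by have [Z ? ?] := branches_omitted hK (lev_branch hK LX) nE al; exists Z.
have [b ba fb] : exists2 b, b < a & forall n, f n <= b.
  apply: contrapT => nb; apply: ncof; exists f; split=> [n|b ba].
    by have [] := fP n.
  apply: contrapT => nn; apply: nb; exists b => // n.
  by rewrite leNgt; apply/negP => bn; apply: nn; exists n.
have [c [Gc bc ca]] := aG b ba.
apply: (no_uniform_avoidance (N := 0) Gc (ltW ca)) => n _.
have [_ [X [LX Xav]]] := fP n.
by exists (f n), X; split=> //; apply: le_lt_trans bc.
Qed.

Lemma family_contradiction : False.
Proof.
have [g' g'P] := club_cofinal_in hK G_cofinal.
(* Index 0 carries a ladder, [n.*2.+1] is a marker for the tree, and [n.*2.+2] carries the omitted
   branch. *)
pose spec a (O : nat -> K -> set K -> Prop) :=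
  (countable_cofinality a -> exists R, [/\ limit_point R a,
     forall b, b < a -> ~ limit_point R b & O = fun i b _ => i = 0 /\ R b])
  /\ (~ countable_cofinality a -> exists n Z, [/\ branches (L n) a Z, ~ L n a Z
     & O = fun i b _ => i = n.*2.+1 \/ i = n.*2.+2 /\ Z b]).
have /choice[O OP] a : exists O, closed_under g' a -> spec a O.
  have [ag|nag] := pselect (closed_under g' a); last by exists (fun _ _ _ => False).
  have [cof|ncof] := pselect (countable_cofinality a).
    have [R [? ?]] := ladder ag.1 cof.
    by exists (fun i b _ => i = 0 /\ R b) => _; split=> // _; exists R.
  have [s sa|n [Z [? ?]]] := exists_omitted _ ag.1 ncof; first exact: g'P.
  exists (fun i b _ => i = n.*2.+1 \/ i = n.*2.+2 /\ Z b) => _.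
  by split=> // _; exists n, Z.
have [b [a [bg ag ba agr]]] := subtle_families hK sK g' O.
have [[x xb] _] := (limit_ordinalP b).1 bg.1.
have sub0 (y : K) : set0 `<=` init y by [].
have {}agr i y : y < b -> O b i y set0 <-> O a i y set0 by move=> yb; apply: agr.
have [Ob1 Ob2] := OP b bg; have [Oa1 Oa2] := OP a ag.
have [acof|ancof] := pselect (countable_cofinality a).
  have [R [Ra Rb Oa]] := Oa1 acof.
  have [bcof|bncof] := pselect (countable_cofinality b).
    have [R' [Rb' _ Ob]] := Ob1 bcof.
    (* The ladders agree below [b], so [b] would be a limit point of the ladder of [a]. *)
    apply: (Rb b ba); apply: limit_pointS Rb' => c cb R'c.
    by have := (agr 0 c cb).1; rewrite Oa Ob => -[].
  have [n [Z [_ _ Ob]]] := Ob2 bncof.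
  by have := (agr n.*2.+1 x xb).1; rewrite Oa Ob => -[]//; left.
have [n [Z [BZ nZ Oa]]] := Oa2 ancof.
have [bcof|bncof] := pselect (countable_cofinality b).
  have [R' [_ _ Ob]] := Ob1 bcof.
  by have := (agr n.*2.+1 x xb).2; rewrite Oa Ob => -[]//; left.
have [n' [Z' [BZ' nZ' Ob]]] := Ob2 bncof.
have e : n = n'.
  have := (agr n.*2.+1 x xb).2; rewrite Oa Ob => -[|[/double_inj//]|[[/(congr1 odd)]]].
  - by left.
  - by rewrite /= !odd_double.
subst n'; apply: nZ'; suff -> : Z' = Z `&` init b by apply: BZ.2.
apply/seteqP; split=> y.
  move=> Z'y; have yb := BZ'.1 _ Z'y; split=> //.
  have := (agr n.*2.+2 y yb).1; rewrite Oa Ob => -[|/eqP|[]//]; first by right.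
  by rewrite eqSS eqn_leq ltnn.
move=> [Zy yb].
have := (agr n.*2.+2 y yb).2; rewrite Oa Ob => -[|/eqP|[]//]; first by right.
by rewrite eqSS eqn_leq ltnn.
Qed.

End Family.

(** * Choice of the trees and of the points guessing correctly for all of them *)

Theorem theorem1 (d : Order.disp_t) (K : orderType d) :
  regular_uncountable_cardinal K -> subtle K -> box_minus K ->
  exists (d' : Order.disp_t) (T : porderType d'), souslin K T /\ full K T.
Proof.
move=> hK sK [C [CsK CcK guess]]; apply: contrapT => nT.
have nbad H W : exists A, bad C H W A.
  apply: not_souslin_bad => // sT; apply: nT.
  by exists (Order.Disp tt tt), (node (lev C H W)); split=> //; apply: node_full.
have [Omega OmegaP] := diamond hK sK.
(* A bad family and a bound are fixed in advance for every pair of a set and an index, so that [H]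
   can be defined by plain recursion. *)
have /choice[F FP] (Hn : set K * nat) : exists r : (K -> set K -> Prop) * (K -> K),
    bad C Hn.1 (fun c => Omega c Hn.2) r.1 /\
    forall s U, lev C Hn.1 (fun c => Omega c Hn.2) s U ->
      exists b V, [/\ s <= b, b < r.2 s, r.1 b V & V `&` init s = U].
  have [A Abad] := nbad Hn.1 (fun c => Omega c Hn.2).
  by have [g gP] := bad_bound hK sK Abad; exists (A, g).
pose caughtF (H : set K) n := caught Omega (fun=> (F (H, n)).1) (fun=> (F (H, n)).2) n.
pose H := fix h n := if n is m.+1 then h m `&` caughtF (h m) m else setT.
pose A n := (F (H n, n)).1; pose g n := (F (H n, n)).2.
pose B : set K := [set c | forall n, caught Omega A g n c].
have BH c n : B c -> H n c by move=> Bc; elim: n => //= n Hc; split=> //; apply: Bc.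
have Bcof : cofinal B.
  move=> a; have /choice[v vP] s : exists v, forall n, g n s < v.
    exact: countable_bounded hK (fun n => g n s).
  have [c [cl cg] cA] := OmegaP A (fun s => Order.max (v s) a).
  have [[x xc] _] := (limit_ordinalP c).1 cl.
  exists c; last by move: (cg x xc); rewrite gt_max => /andP[_ /ltW].
  move=> n; split; last by move=> b X; apply: cA.
  split=> // s /cg; rewrite gt_max => /andP[vc _]; exact: lt_trans (vP _ _) vc.
pose G := [set c | limit_ordinal c /\ isLub (nacc (C c) `&` B) c].
apply: (@family_contradiction _ K hK sK C H Omega A g G CsK CcK).
- by move=> n; have [] := FP (H n, n).
- by move=> n; have [] := FP (H n, n).
- by [].
- move=> a; have [c [cB [cl ca]]] := guess B Bcof _ (club_closed_under hK (fun=> a)).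
  have [[x xc] _] := (limit_ordinalP c).1 cl.
  by exists c => //; apply/ltW/(ca x).
- move=> c m [cl [cub cmin]] mc.
  apply: contrapT => nt; have : c <= m.
    apply: cmin => t [Ct Bt]; rewrite leNgt; apply/negP => mt; apply: nt.
    by exists t; split=> // n; apply: BH.
  by rewrite leNgt mc.
- by move=> c [].
Qed.
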